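(* Let $F_3$ be the free group on $3$ generators and let $T$ be the usual Cayley graph of $F_3$, i.e. the $6$-regular tree. Then the commensurator of $F_3$ in $\mathrm{Aut}(T)$ is dense in $\mathrm{Aut}(T)$.
   Context: $F_3$ is viewed as a subgroup of $\mathrm{Aut}(T)$ via its action on its Cayley graph (with respect to a free generating set). For $\Gamma\le G$, the commensurator of $\Gamma$ in $G$ is the set of $g\in G$ such that $\Gamma\cap g\Gamma g^{-1}$ has finite index in both $\Gamma$ and $g\Gamma g^{-1}$. $\mathrm{Aut}(T)$ carries the topology of pointwise convergence on vertices. *)

(* Defs.v *)
From HB Require Import structures.
From mathcomp Require Import all_boot.
From mathcomp Require Import boolp classical_sets functions cardinality.
From mathcomp Require Import topology.

Set Implicit Arguments.
Unset Strict Implicit.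
Unset Printing Implicit Defensive.

Local Open Scope classical_set_scope.
Local Open Scope group_scope.

(** Free group of rank n: reduced words in the letters x_i = (i, true) and
    x_i^-1 = (i, false). *)

Notation letter n := ('I_n * bool)%type.

Definition letter_inv n (a : letter n) : letter n := (a.1, ~~ a.2).

Definition reduced n (w : seq (letter n)) : bool :=
  sorted (fun a b => b != letter_inv a) w.

Record free_group (n : nat) : Type := FreeGroup {
  word :> seq (letter n);
  word_reduced : reduced word }.

HB.instance Definition _ n := [isSub for @word n].
HB.instance Definition _ n := [Countable of free_group n by <:].

(* The reduced form of a :: w, for w reduced. *)
Definition push n (a : letter n) (w : seq (letter n)) : seq (letter n) :=
  if w is b :: w' then if b == letter_inv a then w' else a :: w else [:: a].

(* The reduced form of u ++ v, for v reduced. *)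
Definition reduced_cat n (u v : seq (letter n)) : seq (letter n) :=
  foldr (@push n) v u.

Definition word_inv n (u : seq (letter n)) : seq (letter n) :=
  rev (map (@letter_inv n) u).

Section FreeGroup.
Variable n : nat.
Implicit Types (a b : letter n) (u v w : seq (letter n)).

Lemma letter_invK : involutive (@letter_inv n).
Proof. by case=> i b; rewrite /letter_inv /= negbK. Qed.

Lemma reduced_push a w : reduced w -> reduced (push a w).
Proof.
case: w => [|b w] //=; case: eqP => [_ /path_sorted //|/eqP ba pw].
by rewrite /reduced /= ba.
Qed.

Lemma pushK a w : reduced w -> push (letter_inv a) (push a w) = w.
Proof.
case: w => [|b w] /=; first by rewrite letter_invK eqxx.
case: eqP => [-> pw|_ _]; last by rewrite /= letter_invK eqxx.
case: w pw => [|c w] //= /andP[ca _].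
by rewrite (negPf ca).
Qed.

Lemma reduced_reduced_cat u v : reduced v -> reduced (reduced_cat u v).
Proof. by move=> rv; elim: u => //= a u; exact: reduced_push. Qed.

Lemma reduced_cat_push a v w : reduced w ->
  reduced_cat (push a v) w = push a (reduced_cat v w).
Proof.
move=> rw; case: v => [|b v] //=; case: eqP => // ->.
have := pushK (letter_inv a) (reduced_reduced_cat v rw).
by rewrite letter_invK.
Qed.

Lemma reduced_catA u v w : reduced w ->
  reduced_cat u (reduced_cat v w) = reduced_cat (reduced_cat u v) w.
Proof. by move=> rw; elim: u => //= a u ->; rewrite reduced_cat_push. Qed.

Lemma reduced_cats0 u : reduced u -> reduced_cat u [::] = u.
Proof.
elim: u => //= a u IHu ru; rewrite IHu; last exact: path_sorted ru.
by case: u ru {IHu} => //= b u /andP[/negPf ->].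
Qed.

Lemma reduced_catVs u v : reduced v ->
  reduced_cat (word_inv u) (reduced_cat u v) = v.
Proof.
elim: u => //= a u IHu rv; rewrite /word_inv /= rev_cons.
rewrite /reduced_cat foldr_rcons pushK; last exact: reduced_reduced_cat.
exact: IHu.
Qed.

Lemma word_invK : involutive (@word_inv n).
Proof. by move=> u; rewrite /word_inv map_rev revK (mapK letter_invK). Qed.

Lemma reduced_word_inv u : reduced u -> reduced (word_inv u).
Proof.
rewrite /reduced /word_inv rev_sorted sorted_map.
by apply: sub_sorted => a b /=; apply: contra => /eqP/(can_inj letter_invK) ->;
  rewrite letter_invK.
Qed.

Definition free_one : free_group n := @FreeGroup n [::] isT.

Definition free_mul (x y : free_group n) : free_group n :=
  FreeGroup (reduced_reduced_cat x (word_reduced y)).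

Definition free_inv (x : free_group n) : free_group n :=
  FreeGroup (reduced_word_inv (word_reduced x)).

Lemma free_mulA : associative free_mul.
Proof.
by move=> x y z; apply/val_inj; exact: (reduced_catA _ _ (word_reduced z)).
Qed.

Lemma free_mul1 : left_id free_one free_mul.
Proof. by move=> x; exact/val_inj. Qed.

Lemma free_mulr1 : right_id free_one free_mul.
Proof. by move=> x; apply/val_inj; exact: reduced_cats0 (word_reduced x). Qed.

Lemma free_mulV : left_inverse free_one free_inv free_mul.
Proof.
move=> x; apply/val_inj => /=.
by rewrite -{2}[word x]reduced_cats0 ?word_reduced // reduced_catVs.
Qed.

Lemma free_mulrV : right_inverse free_one free_inv free_mul.
Proof.
move=> x; rewrite -[RHS](free_mulV (free_inv x)); congr free_mul.
by apply/val_inj; rewrite /= word_invK.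
Qed.

HB.instance Definition _ := isGroup.Build (free_group n)
  free_mulA free_mul1 free_mulr1 free_mulV free_mulrV.

Definition free_gen (i : 'I_n) : free_group n := @FreeGroup n [:: (i, true)] isT.

End FreeGroup.

(** A graph is given by its adjacency relation; the right Cayley graph joins
    g to g s and to g s^-1, so that G acts on it by left translations. *)

Definition cayley_graph (G : groupType) (S : seq G) : rel G :=
  fun g h => has (fun s => (h == g * s) || (g == h * s)) S.

Definition free_cayley_graph (n : nat) : rel (free_group n) :=
  cayley_graph [seq free_gen i | i <- enum 'I_n].
Arguments free_cayley_graph n : clear implicits.

Record graph_aut (V : choiceType) (e : rel V) : Type := GraphAut {
  aut_fun :> V -> V;
  aut_bij : bijective aut_fun;
  aut_adj : forall x y, e (aut_fun x) (aut_fun y) = e x y }.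

HB.instance Definition _ (V : choiceType) (e : rel V) :=
  gen_eqMixin (graph_aut e).
HB.instance Definition _ (V : choiceType) (e : rel V) :=
  gen_choiceMixin (graph_aut e).

Section GraphAut.
Variables (V : choiceType) (e : rel V).
Implicit Types f g h : graph_aut e.

Lemma graph_autP f g : (forall x, f x = g x) -> f = g.
Proof.
case: f g => [f fb fe] [g gb ge] /= fg; have {}fg : f = g by apply/funext.
by case: _ / fg in gb ge *; congr GraphAut; exact: Prop_irrelevance.
Qed.

Definition aut_one : graph_aut e :=
  @GraphAut V e id (Bijective (frefl _) (frefl _)) (fun _ _ => erefl).

Lemma aut_mul_adj f g x y : e (f (g x)) (f (g y)) = e x y.
Proof. by rewrite !aut_adj. Qed.

Definition aut_mul f g : graph_aut e :=
  @GraphAut V e (f \o g) (bij_comp (aut_bij f) (aut_bij g)) (aut_mul_adj f g).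

Lemma aut_inv_ex f : exists g : graph_aut e, cancel f g /\ cancel g f.
Proof.
have [g fK gK] := aut_bij f.
have ge x y : e (g x) (g y) = e x y by rewrite -(aut_adj f) !gK.
by exists (GraphAut (Bijective gK fK) ge).
Qed.

Definition aut_inv f : graph_aut e := sval (cid (aut_inv_ex f)).

Lemma aut_mulA : associative aut_mul.
Proof. by move=> f g h; exact: graph_autP. Qed.

Lemma aut_mul1 : left_id aut_one aut_mul.
Proof. by move=> f; exact: graph_autP. Qed.

Lemma aut_mulr1 : right_id aut_one aut_mul.
Proof. by move=> f; exact: graph_autP. Qed.

Lemma aut_mulV : left_inverse aut_one aut_inv aut_mul.
Proof.
by move=> f; apply: graph_autP => x; rewrite /aut_inv; case: cid => g [fK gK];
  exact: fK.
Qed.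

Lemma aut_mulrV : right_inverse aut_one aut_inv aut_mul.
Proof.
by move=> f; apply: graph_autP => x; rewrite /aut_inv; case: cid => g [fK gK];
  exact: gK.
Qed.

HB.instance Definition _ := isGroup.Build (graph_aut e)
  aut_mulA aut_mul1 aut_mulr1 aut_mulV aut_mulrV.

(* Pointwise convergence on the vertices, the vertex set being discrete. *)
HB.instance Definition _ := Topological.copy (graph_aut e)
  (initial_topology (fun f : graph_aut e =>
     (f : V -> V) : {ptws V -> discrete_topology V})).

End GraphAut.

Section LeftTranslation.
Variables (G : groupType) (S : seq G).

Lemma ltrans_bij (g : G) : bijective (fun x : G => g * x).
Proof. by exists (fun x => g^-1 * x); [exact: mulKg | exact: mulVKg]. Qed.

Lemma ltrans_adj (g x y : G) :
  cayley_graph S (g * x) (g * y) = cayley_graph S x y.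
Proof. by apply: eq_has => s; rewrite -!mulgA !(inj_eq (mulgI g)). Qed.

Definition ltrans (g : G) : graph_aut (cayley_graph S) :=
  GraphAut (ltrans_bij g) (ltrans_adj g).

Lemma ltransM : {morph ltrans : g h / g * h}.
Proof. by move=> g h; apply: graph_autP => x; rewrite /= mulgA. Qed.

Lemma ltrans_inj : injective ltrans.
Proof. by move=> g h /(congr1 (fun f => aut_fun f 1)); rewrite /= !mulg1. Qed.

End LeftTranslation.

(* The copy of F_n inside the automorphism group of its Cayley graph. *)
Definition free_in_aut (n : nat) : set (graph_aut (free_cayley_graph n)) :=
  range (@ltrans (free_group n) [seq free_gen i | i <- enum 'I_n]).
Arguments free_in_aut n : clear implicits.

Section Commensurator.
Variable G : groupType.

Definition conj_set (g : G) (H : set G) : set G := [set g * h * g^-1 | h in H].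

(* For subgroups H `<=` K: finitely many left cosets k H with k in K. *)
Definition finite_index (H K : set G) : Prop :=
  finite_set [set [set k * h | h in H] | k in K].

Definition commensurator (Gamma : set G) : set G :=
  [set g | finite_index (Gamma `&` conj_set g Gamma) Gamma /\
           finite_index (Gamma `&` conj_set g Gamma) (conj_set g Gamma)].

End Commensurator.

(* Main.v *)
Require Import Defs.
From mathcomp Require Import all_boot perm.
From mathcomp Require Import boolp classical_sets functions cardinality.
From mathcomp Require Import topology.

(** Let F be the free group of rank n and T its Cayley graph. An automorphism
    g of T permutes, at each vertex x, the letters that label the edges leaving
    x: g (x a) = g x * s_x(a). These local permutations satisfy
      s_(x a)(a^-1) = s_x(a)^-1,
    since both sides describe the way back along one edge, and conversely a
    family of permutations with this property, together with the value g 1,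
    determines an automorphism.

    If x |-> s_x factors through an action of F on a finite set Q, that is, if
    g is computed by a finite transducer with states Q, then for h in the
    finite-index stabilizer of the base state, g and g o h have the same local
    permutations, so g h g^-1 is again a left translation. The inverse of g is
    computed by a transducer with the same states, so that both indices in the
    definition of the commensurator are finite
    ([transducer_aut_commensurator]).

    It remains to approximate a given f by transducers on a ball B, which is
    enough because basic open sets constrain finitely many vertices
    ([open_agree]). Take Q = B x Perm(letters), a state (v, t) acting on letters
    by t, and let the vertex v of B correspond to the state (v, s_v) where s_v
    is the local permutation of f. A generator x_i has to act on Q by a
    permutation taking each (v, t) to some (v', t') with t'(x_i^-1) = t(x_i)^-1.
    The map (v, t) |-> (v, iota t iota), with iota the inversion of letters, is
    one such permutation; composing it with transpositions makes it follow the
    edges of B as well ([perm_extend]). The resulting transducer computes f on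
    B ([shadowing_transducer]). *)

Set Implicit Arguments.
Unset Strict Implicit.
Unset Printing Implicit Defensive.

Local Open Scope classical_set_scope.
Local Open Scope group_scope.

(** * Letters and edges of the Cayley graph *)

Section Letters.
Variable n : nat.
Implicit Types (a b : letter n) (x y : free_group n).

Definition letter_elt a : free_group n := @FreeGroup n [:: a] isT.

Lemma letter_elt_inj : injective letter_elt.
Proof. by move=> a b []. Qed.

Lemma letter_eltV a : letter_elt a * letter_elt (letter_inv a) = 1.
Proof. by apply/val_inj; rewrite /= eqxx. Qed.

Lemma free_ind (P : free_group n -> Prop) :
  P 1 -> (forall a x, P x -> P (letter_elt a * x)) -> forall x, P x.
Proof.
move=> P1 Pa [w]; elim: w => [|a w IHw] rw.
  by suff -> : FreeGroup rw = 1 by []; exact/val_inj.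
have rw' : reduced w by exact: path_sorted rw.
have -> : FreeGroup rw = letter_elt a * FreeGroup rw'.
  apply/val_inj; change (a :: w = push a w).
  by case: w rw {rw' IHw} => //= b w /andP[/negPf->].
exact/Pa/IHw.
Qed.

Lemma free_cayley_graphP x y :
  reflect (exists a, y = x * letter_elt a) (free_cayley_graph n x y).
Proof.
have genE i : free_gen i = letter_elt (i, true) by exact/val_inj.
apply: (iffP hasP) => [[s /mapP[i _ ->]]|[[i b] ->]].
  rewrite genE => /orP[/eqP->|/eqP->]; first by exists (i, true).
  by exists (i, false); rewrite -mulgA (letter_eltV (i, true)) mulg1.
exists (free_gen i); first by rewrite map_f ?mem_enum.
rewrite genE; case: b; rewrite ?eqxx //.
by rewrite -mulgA (letter_eltV (i, false)) mulg1 eqxx orbT.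
Qed.

End Letters.

(** * Finite transducers acting on the tree *)

(** [stepK] makes [step] a right action of the free group on the states, and
    [out_step] says that an edge and its reverse are sent to an edge and its
    reverse. *)
Record transducer (n : nat) := Transducer {
  state : finType;
  step : letter n -> state -> state;
  out : state -> {perm letter n};
  stepK : forall a q, step (letter_inv a) (step a q) = q;
  out_step : forall a q,
    out (step a q) (letter_inv a) = letter_inv (out q a) }.

Section Transducer.
Variable n : nat.
Implicit Types (A : transducer n) (x y : free_group n).

Definition run A (q : state A) x : state A := foldl (fun q a => step a q) q x.

Fixpoint transduce_word A (q : state A) (w : seq (letter n)) : free_group n :=
  if w is a :: w' then letter_elt (out q a) * transduce_word (step a q) w'
  else 1.

Definition transduce A (q : state A) x := transduce_word q x.

(** If the product cancels, [stepK] undoes the step along the first letter. *)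
Lemma run_letterM A (q : state A) a x :
  run q (letter_elt a * x) = run (step a q) x.
Proof.
case: x => [[|b w]] rw //; rewrite /run /=.
by case: eqP => [->|//]; rewrite /= stepK.
Qed.

Lemma runM A (q : state A) x y : run q (x * y) = run (run q x) y.
Proof.
elim/free_ind: x q => [|a x IHx] q; first by rewrite mul1g.
by rewrite -mulgA !run_letterM.
Qed.

(** If the product cancels, so do the two output letters, by [out_step]. *)
Lemma transduce_letterM A (q : state A) a x :
  transduce q (letter_elt a * x) =
    letter_elt (out q a) * transduce (step a q) x.
Proof.
case: x => [[|b w]] rw //; rewrite /transduce /=.
case: eqP => [->|//]; rewrite /= stepK out_step mulgA.
by rewrite letter_eltV mul1g.
Qed.

(** The cocycle identity: for x in the stabilizer of q it turns the
    precomposition of [transduce q] with the translation by x into a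
    postcomposition with a translation. *)
Lemma transduceM A (q : state A) x y :
  transduce q (x * y) = transduce q x * transduce (run q x) y.
Proof.
elim/free_ind: x q => [|a x IHx] q; first by rewrite !mul1g.
by rewrite -mulgA !transduce_letterM run_letterM IHx mulgA.
Qed.

(** The inverse tree map reads the letter b where the original one writes it,
    so it follows the edge that [out q] sends to b. *)
Program Definition transducer_inv A : transducer n := {|
  state := state A;
  step b q := step ((out q)^-1 b) q;
  out q := (out q)^-1 |}.
Next Obligation.
move=> A b q; rewrite -{1}[b](permKV (out q)) -out_step permK.
exact: stepK.
Qed.
Next Obligation.
move=> A b q /=; rewrite -{2}[b](permKV (out q)) -out_step permK.
by [].
Qed.

Lemma transduceK A (q : state A) :
  cancel (transduce q) (transduce (q : state (transducer_inv A))).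
Proof.
move=> x; elim/free_ind: x q => [//|a x IHx] q.
by rewrite !transduce_letterM /= permK IHx.
Qed.

Lemma transduceKV A (q : state A) :
  cancel (transduce (q : state (transducer_inv A))) (transduce q).
Proof.
move=> x; elim/free_ind: x q => [//|b x IHx] q.
by rewrite !transduce_letterM /= permKV IHx.
Qed.

Lemma transduce_adj A (q : state A) x y :
  free_cayley_graph n (transduce q x) (transduce q y) = free_cayley_graph n x y.
Proof.
have adj B (r : state B) u v : free_cayley_graph n u v ->
    free_cayley_graph n (transduce r u) (transduce r v).
  move=> /free_cayley_graphP[a ->]; rewrite transduceM.
  apply/free_cayley_graphP; exists (out (run r u) a).
  by rewrite -[letter_elt a]mulg1 transduce_letterM mulg1.
apply/idP/idP; last exact: adj.
by move=> /(@adj (transducer_inv A) q); rewrite !transduceK.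
Qed.

Definition transducer_aut A (q : state A) : graph_aut (free_cayley_graph n) :=
  GraphAut (Bijective (transduceK q) (transduceKV q)) (transduce_adj q).

End Transducer.

(** * Neighbourhoods for pointwise convergence *)

Section Topology.
Variables (V : choiceType) (e : rel V).

Definition agree_filter (f : V -> V) : set_system (V -> V) :=
  [set A | exists E : seq V, forall g : V -> V, {in E, g =1 f} -> A g].

Lemma agree_filter_filter f : Filter (agree_filter f).
Proof.
split=> [|P Q [E PE] [E' QE']|P Q PQ [E PE]]; first by exists [::].
  exists (E ++ E') => g gf; split; [apply: PE|apply: QE'] => x xE;
    by apply: gf; rewrite mem_cat xE ?orbT.
by exists E => g /PE /PQ.
Qed.

Lemma agree_filter_cvg (f : V -> V) :
  agree_filter f --> (f : {ptws V -> discrete_topology V}).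
Proof.
have FF := agree_filter_filter f.
apply/cvg_sup => x A [_ [[W oW <-] Wf] WA].
by exists [:: x] => g gf; apply: WA; rewrite /= gf ?mem_head.
Qed.

(** An open set belongs to every filter converging to one of its points, in
    particular to the filter of agreement on finite sets. *)
Lemma open_agree (O : set (graph_aut e)) (f : graph_aut e) : open O -> O f ->
  exists E : seq V, forall g : graph_aut e, {in E, g =1 f} -> O g.
Proof.
move=> [U oU <-] /= Uf.
have [E UE] := agree_filter_cvg (open_nbhs_nbhs (conj oU Uf)).
by exists E => g gf; exact: UE.
Qed.

End Topology.

(** * Transducer automorphisms commensurate the free group *)

Lemma finite_index_fibers (G : groupType) (H K : set G) (Q : finType)
    (phi : G -> Q) :
  (forall h h', H h -> H h' -> H (h^-1 * h')) ->
  (forall k k', K k -> K k' -> phi k = phi k' -> H (k^-1 * k')) ->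
  finite_index H K.
Proof.
move=> HV phiH.
pose coset (q : Q) : set G :=
  [set x | exists k, [/\ K k, phi k = q & H (k^-1 * x)]].
apply: (@sub_finite_set _ _ (range coset));
  last exact/finite_image/finite_finset.
move=> _ [k Kk <-]; exists (phi k) => //; rewrite eqEsubset; split=> x.
  move=> [k' [Kk' eq_phi Hx]]; exists (k^-1 * x); last by rewrite mulVKg.
  have := HV _ _ (phiH _ _ Kk' Kk eq_phi) Hx.
  by rewrite invgM invgK -mulgA mulVKg.
by move=> [h Hh <-]; exists k; split=> //; rewrite mulKg.
Qed.

Section Commensuration.
Variables (n : nat).
Local Notation Aut := (graph_aut (free_cayley_graph n)).
Local Notation Gamma := (free_in_aut n).
Local Notation ltrans :=
  (@ltrans (free_group n) [seq free_gen i | i <- enum 'I_n]).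

Lemma ltransVM x y : (ltrans x)^-1 * ltrans y = ltrans (x^-1 * y).
Proof. by apply: (mulgI (ltrans x)); rewrite -ltransM !mulVKg. Qed.

Lemma free_in_aut_divl (g h : Aut) : Gamma g -> Gamma h -> Gamma (g^-1 * h).
Proof.
by move=> [x _ <-] [y _ <-]; exists (x^-1 * y) => //; rewrite ltransVM.
Qed.

(** Finiteness of the two indices, with [phi] separating enough cosets in the
    conjugate of the free group and [psi] in the free group itself. *)
Lemma commensurator_fibers (g : Aut) (Q Q' : finType)
    (phi : free_group n -> Q) (psi : free_group n -> Q') :
  (forall x y, phi x = phi y ->
     exists z, g * ltrans (x^-1 * y) = ltrans z * g) ->
  (forall x y, psi x = psi y ->
     exists z, ltrans (x^-1 * y) * g = g * ltrans z) ->
  commensurator Gamma g.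
Proof.
move=> phiG psiG.
have HVM k k' : (Gamma `&` conj_set g Gamma) k ->
    (Gamma `&` conj_set g Gamma) k' ->
    (Gamma `&` conj_set g Gamma) (k^-1 * k').
  move=> [Gk [h Gh hk]] [Gk' [h' Gh' hk']]; split;
    first exact: free_in_aut_divl.
  exists (h^-1 * h'); first exact: free_in_aut_divl.
  by rewrite -hk -hk' !invgM invgK !mulgA mulgVK.
split.
  (* The translation by x is recovered from its value x at 1. *)
  apply: (@finite_index_fibers _ _ _ _ (fun k : Aut => psi (k 1))) => //.
  move=> _ _ [x _ <-] [y _ <-]; rewrite /= !mulg1 => /psiG[z gz].
  rewrite ltransVM; split; first by exists (x^-1 * y).
  by exists (ltrans z); [exists z|rewrite -gz mulgK].
apply: (@finite_index_fibers _ _ _ _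
  (fun k : Aut => phi ((g^-1 * k * g) 1))) => //.
move=> _ _ [_ [x _ <-] <-] [_ [y _ <-] <-].
have conjgK u : g^-1 * (g * u * g^-1) * g = u.
  by rewrite !mulgA mulVg mul1g mulgVK.
rewrite !conjgK /= !mulg1 => /phiG[z gz].
rewrite !invgM invgK -!mulgA mulKg (mulgA (ltrans x)^-1) ltransVM mulgA gz.
split; first by exists z => //; rewrite mulgK.
by exists (ltrans (x^-1 * y)); [exists (x^-1 * y) | rewrite gz].
Qed.

(** Inverses appear in the two maps to finite sets because the free group acts
    on the states from the right, whereas the index counts left cosets: if
    x^-1 and y^-1 move q to the same state, then x^-1 y stabilizes q. The
    translation by t conjugates the stabilizer for the inverse transducer. *)
Lemma transducer_aut_commensurator (A : transducer n) (q : state A)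
    (t : free_group n) :
  commensurator Gamma (ltrans t * transducer_aut q).
Proof.
pose q' : state (transducer_inv A) := q.
have transduce_stab w u : run q' w = q' ->
    transduce q (transduce q' w * u) = w * transduce q u.
  move=> q'w; rewrite -[RHS](transduceKV q); congr transduce.
  by rewrite transduceM q'w transduceK.
apply: (@commensurator_fibers _ _ _ (fun x => run q x^-1)
                                    (fun x => run q' (t^-1 * x^-1))).
  move=> x y eq_xy; have qK : run q (x^-1 * y) = q.
    by rewrite runM eq_xy -runM mulVg.
  exists (t * transduce q (x^-1 * y) * t^-1); apply: graph_autP => u /=.
  by rewrite transduceM qK -!mulgA mulKg.
move=> x y eq_xy; have q'K : run q' (t^-1 * (x^-1 * y) * t) = q'.
  have -> : t^-1 * (x^-1 * y) * t = (t^-1 * x^-1) * (y * t) by rewrite !mulgA.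
  by rewrite runM eq_xy -runM -mulgA mulKg mulVg.
exists (transduce q' (t^-1 * (x^-1 * y) * t)); apply: graph_autP => u /=.
by rewrite transduce_stab // -!mulgA mulVKg.
Qed.

End Commensuration.

(** * Transducers following a given automorphism on a ball *)

(** Prescribe the values one at a time. Postcomposing p with the transposition
    of [p (i x)] and [j x] sets the value at [i x] to [j x]; these two elements
    have the same colour [d], so the colour condition survives, and injectivity
    of i and j protects the values already prescribed. *)
Lemma perm_extend (Q : finType) (C : eqType) (c d : Q -> C) (p0 : {perm Q})
    (T : eqType) (D : seq T) (i j : T -> Q) :
  {in D &, injective i} -> {in D &, injective j} ->
  (forall q, d (p0 q) = c q) -> {in D, forall x, d (j x) = c (i x)} ->
  exists p : {perm Q},
    (forall q, d (p q) = c q) /\ {in D, forall x, p (i x) = j x}.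
Proof.
move=> + + dp0; elim: D => [|x D IHD] i_inj j_inj dj; first by exists p0.
have sD : {subset D <= x :: D} by move=> y; rewrite inE orbC => ->.
have [|||p [dp pD]] := IHD.
- exact: sub_in2 i_inj.
- exact: sub_in2 j_inj.
- exact: sub_in1 dj.
have djx := dj x (mem_head x D).
exists (p * tperm (p (i x)) (j x))%g; split=> [q|y].
  rewrite permM; case: tpermP => [/perm_inj->||_ _] //.
  by move=> pq; rewrite dp -djx -pq dp.
rewrite permM => yD; have [->|yx] := eqVneq y x; first by rewrite tpermL.
have {}yD' : y \in D by move: yD; rewrite inE (negPf yx).
rewrite (pD y) // tpermD //.
  rewrite -(pD y) // (inj_eq perm_inj).
  by apply: contraNneq yx => /i_inj->; rewrite ?mem_head.
by apply: contraNneq yx => /j_inj->; rewrite ?mem_head.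
Qed.

Section Shadowing.
Variables (n : nat) (f : graph_aut (free_cayley_graph n)).

Lemma local_perm_ex x :
  exists s : {perm letter n}, forall a,
    f (x * letter_elt a) = f x * letter_elt (s a).
Proof.
have /choice[s fs] a : exists b, f (x * letter_elt a) = f x * letter_elt b.
  by apply/free_cayley_graphP; rewrite aut_adj;
    apply/free_cayley_graphP; exists a.
have s_inj : injective s.
  move=> a b sab; apply/letter_elt_inj/(mulgI x)/(bij_inj (aut_bij f)).
  by rewrite !fs sab.
by exists (perm s_inj) => a; rewrite permE.
Qed.

Lemma local_perm_inv (s : free_group n -> {perm letter n}) :
  (forall x a, f (x * letter_elt a) = f x * letter_elt (s x a)) ->
  forall x a, s (x * letter_elt a) (letter_inv a) = letter_inv (s x a).
Proof.
move=> fs x a; apply/letter_elt_inj/(mulgI (f (x * letter_elt a))).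
by rewrite -fs -mulgA letter_eltV mulg1 fs -mulgA letter_eltV mulg1.
Qed.

(** The first component of a state keeps the states of distinct vertices of B
    distinct, even where f has the same local permutation; the second one
    ranges over all permutations so that [flip] is a bijection. *)
Lemma shadowing_transducer (B : seq (free_group n)) : 1 \in B ->
  exists (A : transducer n) (r : free_group n -> state A),
    forall x a, x \in B -> x * letter_elt a \in B ->
      step a (r x) = r (x * letter_elt a) /\
      f (x * letter_elt a) = f x * letter_elt (out (r x) a).
Proof.
move=> B1; have /choice[s fs] := local_perm_ex.
have sV := local_perm_inv fs.
pose Q : finType := (seq_sub B * {perm letter n})%type.
pose r x : Q := (insubd (SeqSub B1) x, s x).
have r_inj : {in B &, injective r}.
  by move=> x y xB yB [/(congr1 val) + _]; rewrite !val_insubd xB yB.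
pose iota : {perm letter n} := perm (inv_inj (@letter_invK n)).
pose flip (q : Q) : Q := (q.1, (iota * q.2 * iota)%g).
have flipK : involutive flip.
  move=> [x t]; congr (_, _); apply/permP => a.
  by rewrite /= !permM !permE !letter_invK.
(* Only positive letters need a choice: the inverse letters get the inverse
   permutations, for which the colour condition is the same one. *)
have /choice[p pP] (i : 'I_n) : exists p : {perm Q},
    (forall q, (p q).2 (i, false) = letter_inv (q.2 (i, true))) /\
    {in [seq x <- B | x * letter_elt (i, true) \in B],
      forall x, p (r x) = r (x * letter_elt (i, true))}.
  apply: (@perm_extend _ _ (fun q : Q => letter_inv (q.2 (i, true)))
           (fun q : Q => q.2 (i, false)) (perm (inv_inj flipK))).
  - by move=> x y; rewrite !mem_filter => /andP[_ xB] /andP[_ yB]; exact: r_inj.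
  - move=> x y; rewrite !mem_filter => /andP[xB _] /andP[yB _] /r_inj.
    by move=> /(_ xB yB)/mulIg.
  - by move=> q; rewrite permE /= !permM !permE.
  - by move=> x _; rewrite /= -sV.
pose st (a : letter n) (q : Q) : Q := if a.2 then p a.1 q else (p a.1)^-1%g q.
have stK a q : st (letter_inv a) (st a q) = q.
  by case: a => i [] /=; rewrite /st /= ?permK ?permKV.
have st_out a q : (st a q).2 (letter_inv a) = letter_inv (q.2 a).
  case: a => i []; rewrite /st /=; first by case: (pP i) => ->.
  have [pi _] := pP i; rewrite -{2}[q](permKV (p i)) pi.
  by rewrite letter_invK.
exists (Transducer stK st_out), r => x a xB yB; split; last exact: fs.
case: a yB => i [] yB /=; rewrite /st /=.
  by have [_ ->] := pP i; rewrite ?mem_filter ?yB.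
apply: (canLR (permK (p i))); have [_ ->] := pP i.
  by rewrite -mulgA (letter_eltV (i, false)) mulg1.
by rewrite mem_filter yB -mulgA (letter_eltV (i, false)) mulg1 xB.
Qed.

Fixpoint ball (k : nat) : seq (free_group n) :=
  if k is k'.+1 then
    ball k' ++ [seq x * letter_elt a | x <- ball k', a <- enum {: letter n}]
  else [:: 1].

Lemma ball_step k x a : x \in ball k -> x * letter_elt a \in ball k.+1.
Proof.
move=> xB; rewrite mem_cat; apply/orP; right.
by apply/allpairsP; exists (x, a); split; rewrite ?mem_enum.
Qed.

Lemma sub_ball k m : k <= m -> {subset ball k <= ball m}.
Proof.
move=> /subnK<-; elim: (m - k)%N => // l IHl x /IHl xB.
by rewrite addSn /= mem_cat xB.
Qed.

Lemma mem_ball x : exists k, x \in ball k.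
Proof.
suff H k y : y \in ball k -> exists l, y * x \in ball l.
  by rewrite -[x]mul1g; apply: (H 0%N); rewrite mem_head.
elim/free_ind: x k y => [|a x IHx] k y yB; first by exists k; rewrite mulg1.
by rewrite mulgA; apply: (IHx k.+1); exact: ball_step.
Qed.

Lemma sub_seq_ball (E : seq (free_group n)) : exists k, {subset E <= ball k}.
Proof.
elim: E => [|x E [k Ek]]; first by exists 0%N.
have [l xl] := mem_ball x; exists (maxn k l) => y.
rewrite inE => /predU1P[->|/Ek yk]; first exact: sub_ball (leq_maxr _ _) _ xl.
exact: sub_ball (leq_maxl _ _) _ yk.
Qed.

(** Every vertex of a ball is reached from 1 by a path inside the ball, along
    which the states are those prescribed by [shadowing_transducer]. *)
Lemma transducer_aut_shadow k :
  exists (A : transducer n) (q : state A),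
    {in ball k, forall x, f x = f 1 * transduce q x}.
Proof.
have B1 : 1 \in ball k by exact: sub_ball (leq0n k) _ (mem_head _ _).
have [A [r rP]] := shadowing_transducer B1; exists A, (r 1).
suff H l : l <= k ->
    {in ball l, forall x, run (r 1) x = r x /\ f x = f 1 * transduce (r 1) x}.
  by move=> x /(H k (leqnn k))[].
elim: l => [_ x|l IHl lk x]; first by rewrite inE => /eqP->; rewrite mulg1.
rewrite mem_cat => /orP[/(IHl (ltnW lk))//|/allpairsP[[y a] /= [yB _ ->]]].
have [run_y fy] := IHl (ltnW lk) y yB.
have [] := rP y a (sub_ball (ltnW lk) yB) (sub_ball lk (ball_step a yB)).
move=> st_y fya; rewrite runM transduceM run_y -[letter_elt a]mulg1.
rewrite run_letterM transduce_letterM mulg1 st_y; split=> //.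
by rewrite fya fy mulgA mulg1.
Qed.

End Shadowing.

(** * Density *)

Theorem commensurator_free_dense n :
  @dense (graph_aut (free_cayley_graph n)) (commensurator (free_in_aut n)).
Proof.
move=> O [f Of] oO; have [E EO] := open_agree oO Of.
have [k Ek] := sub_seq_ball E.
have [A [q fq]] := transducer_aut_shadow f k.
exists (ltrans _ (f 1) * transducer_aut q); split.
  by apply: EO => x /Ek /fq ->.
exact: transducer_aut_commensurator.
Qed.

Theorem corollary7 :
  @dense (graph_aut (free_cayley_graph 3)) (commensurator (free_in_aut 3)).
Proof. exact: commensurator_free_dense. Qed.
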